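(* For every $0<\varepsilon<1$ there is a deterministic, stateless, $(1-\varepsilon)$-approximate $\mathrm{CentLocal}[\varphi]$-algorithm for maximum matching, where $\varphi=(\log^* n)^{\lceil 1/\varepsilon\rceil +1}\cdot 2^{\Delta^{O(1/\varepsilon)}}$. That is, on a query edge $e$ it answers whether $e\in M$, where $M$ is a fixed matching of $G$ with $|M|\ge(1-\varepsilon)|M^*|$ for a maximum cardinality matching $M^*$.
   Context: Graphs are undirected and labeled: $n$ vertices with distinct IDs in $\{1,\dots,n\}$, each vertex $v$ has ports $1,\dots,\deg(v)$ pointing to its neighbors in an arbitrary fixed way; $\Delta$ is the maximum degree. In the CentLocal model an algorithm knows $n,\Delta$ and accesses the graph only via probes $(v,i)$ returning the $i$-th neighbor of $v$ (and the port number of $v$ at that neighbor), or null. It answers an online sequence of queries and must be consistent with a single fixed solution for all query sequences. $\mathrm{CentLocal}[q]$ means consistent with at most $q$ probes per query; stateless means no information is stored between queries. *)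

(* Defs.v *)
From mathcomp Require Import all_boot all_order all_algebra archimedean.
From mathcomp Require Import reals exp.

Set Implicit Arguments.
Unset Strict Implicit.
Unset Printing Implicit Defensive.

Import Order.TTheory GRing.Theory Num.Theory.
Local Open Scope ring_scope.

(* A vertex is identified with its ID; IDs are shifted to {0, ..., n-1}.
   Port i (1 <= i <= deg v) of v leads to the (i-1)-th entry of [nbrs v], so
   the order of the list is the arbitrary port assignment. *)
Record labeled_graph (n : nat) := LabeledGraph {
  nbrs : 'I_n -> seq 'I_n;
  nbrs_uniq : forall v, uniq (nbrs v);
  nbrs_irrefl : forall v, v \notin nbrs v;
  nbrs_sym : forall u v, (u \in nbrs v) = (v \in nbrs u)
}.

Section Graph.
Variables (n : nat) (G : labeled_graph n).

Definition deg (v : 'I_n) : nat := size (nbrs G v).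

Definition max_degree : nat := (\max_(v < n) deg v)%N.

Definition edges : {set {set 'I_n}} :=
  [set e | [exists u, exists v, (v \in nbrs G u) && (e == [set u; v])]].

Definition matching (M : {set {set 'I_n}}) : Prop :=
  M \subset edges /\ trivIset M.

Definition maximum_matching (M : {set {set 'I_n}}) : Prop :=
  matching M /\ forall M', matching M' -> (#|M'| <= #|M|)%N.

(* The second component of a reply is the port of v at the neighbor found. *)
Definition probe (v : 'I_n) (i : nat) : option ('I_n * nat) :=
  if i is j.+1 then
    omap (fun u => (u, (index v (nbrs G u)).+1)) (onth (nbrs G v) j)
  else None.

End Graph.

Definition approx_max_matching (R : realType) (eps : R) (n : nat)
    (G : labeled_graph n) (M : {set {set 'I_n}}) : Prop :=
  matching G M /\
  forall Mstar, maximum_matching G Mstar ->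
    (1 - eps) * #|Mstar|%:R <= #|M|%:R.

(* A deterministic adaptive probing strategy ending with a result in A. *)
Inductive probing (n : nat) (A : Type) : Type :=
| Return of A
| Probe of 'I_n & nat & (option ('I_n * nat) -> probing n A).

Arguments Return {n A} _.
Arguments Probe {n A} _ _ _.

Fixpoint exec (n : nat) (A : Type) (G : labeled_graph n) (t : probing n A) : A :=
  match t with
  | Return a => a
  | Probe v i k => exec G (k (probe G v i))
  end.

Fixpoint probes (n : nat) (A : Type) (G : labeled_graph n) (t : probing n A) : nat :=
  match t with
  | Return _ => 0
  | Probe v i k => (probes G (k (probe G v i))).+1
  end.

(* A deterministic algorithm answering edge queries.  The second index D is the
   maximum degree of the input graph, which the algorithm knows along with n.
   The state is what is stored from one query to the next. *)
Record edge_algorithm := EdgeAlgorithm {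
  state : nat -> nat -> Type;
  init : forall n D, state n D;
  answer : forall n D, state n D -> {set 'I_n} -> probing n (bool * state n D)
}.

Definition stateless (A : edge_algorithm) : Prop :=
  forall n D (s t : state A n D), s = t.

(* The answer to each query of the sequence with the number of probes made. *)
Fixpoint run (A : edge_algorithm) (n : nat) (G : labeled_graph n) (D : nat)
    (s : state A n D) (qs : seq {set 'I_n}) : seq (bool * nat) :=
  if qs is e :: qs' then
    let t := answer s e in
    ((exec G t).1, probes G t) :: run G (exec G t).2 qs'
  else [::].

(* CentLocal[q] for the problem of finding an edge set satisfying [sol]. *)
Definition CentLocal (R : realType)
    (sol : forall n, labeled_graph n -> {set {set 'I_n}} -> Prop)
    (q : nat -> nat -> R) (A : edge_algorithm) : Prop :=
  forall n (G : labeled_graph n), exists M : {set {set 'I_n}},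
    sol n G M /\
    forall qs : seq {set 'I_n}, {subset qs <= edges G} ->
      let r := run G (init A n (max_degree G)) qs in
      unzip1 r = [seq e \in M | e <- qs] /\
      {in unzip2 r, forall p : nat, p%:R <= q n (max_degree G)}.

Section LogStar.
Variable R : realType.

Definition log2 (x : R) : R := ln x / ln 2.

Lemma log2_iter_le1 (n : nat) : exists k, iter k log2 n%:R <= 1.
Proof.
suff H (m : nat) : forall x : R, x <= m%:R -> exists k, iter k log2 x <= 1.
  exact: (H n).
elim: m => [|m IHm] x lexm.
  by exists 0; rewrite /= (le_trans lexm) ?ler01.
have [x_le1|x_gt1] := leP x 1; first by exists 0.
have x_gt0 : 0 < x by exact: lt_trans x_gt1.
have [|k lek] := IHm (log2 x); last by exists k.+1; rewrite iterSr.
have ln2_gt0 : 0 < ln (2 : R) by rewrite ln_gt0 // ltr1n.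
rewrite /log2 ler_pdivrMr // mulr_natl -lnXn // ler_ln ?posrE ?exprn_gt0 //.
by rewrite (le_trans lexm) // -natrX ler_nat ltn_expl.
Qed.

Definition logstar (n : nat) : nat := ex_minn (log2_iter_le1 n).

(* (log* n)^(ceil(1/eps) + 1) * 2^(D^(C/eps)), with C the constant hidden in the
   O(1/eps) of the exponent. *)
Definition probe_bound (C eps : R) (n D : nat) : R :=
  (logstar n)%:R ^ (Num.ceil (1 / eps) + 1) * 2 `^ (D%:R `^ (C / eps)).

End LogStar.

(* Main.v *)
Require Import Defs.
From mathcomp Require Import all_boot all_order all_algebra.
From mathcomp Require Import finfield archimedean boolp reals exp.
From mathcomp Require Import zify lra.

(** The algorithm first colours the R-th power of G, for R = O(1/eps), with
    Delta^O(1/eps) colours: Cole-Vishkin along log* n steps of each of the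
    functional graphs covering that power, followed by one step of Linial's
    colour reduction.  It then improves the empty matching by local search.  At
    each step all vertices of one colour act simultaneously, each of them
    augmenting the current matching inside a small ball around it if it can;
    the balls are disjoint since the colours are proper for the power graph.

    No Hopcroft-Karp phases are needed.  Let m be the current matching and s
    an optimal one.  Following edges of s and m alternately from the m-free
    vertices shows that, as long as m is not (1 - eps)-approximate, a number of
    m-free vertices proportional to eps |s| start augmenting paths of length
    O(1/eps).  A sweep over all colours matches a free vertex near each of them,
    hence at least a Delta^-O(1/eps) fraction as many free vertices, and
    Delta^O(1/eps) sweeps suffice.  Evaluating the resulting recursion of depth
    Delta^O(1/eps) at one vertex costs 2^(Delta^O(1/eps)) evaluations of the
    colouring, each of which costs O(log* n) Delta^O(1/eps) probes. *)

Set Implicit Arguments.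
Unset Strict Implicit.
Unset Printing Implicit Defensive.

(** * Probing strategies and their probe complexity *)

Fixpoint bind (n : nat) (A B : Type) (t : probing n A) (k : A -> probing n B) :
    probing n B :=
  match t with
  | Return a => k a
  | Probe v i c => Probe v i (fun o => bind (c o) k)
  end.

Lemma exec_bind (n : nat) (A B : Type) (G : labeled_graph n) (t : probing n A)
    (k : A -> probing n B) : exec G (bind t k) = exec G (k (exec G t)).
Proof. by elim: t => //= v i c IH; rewrite IH. Qed.

Lemma probes_bind (n : nat) (A B : Type) (G : labeled_graph n)
    (t : probing n A) (k : A -> probing n B) :
  probes G (bind t k) = probes G t + probes G (k (exec G t)).
Proof. by elim: t => //= v i c IH; rewrite IH addSn. Qed.

Definition degree_le (n D : nat) (G : labeled_graph n) :=
  forall v, deg G v <= D.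

(** One strategy must serve all graphs on [n] vertices of degree at most [D]. Only probes are
    counted; the computation between them is arbitrary. *)
Definition computable (n D q : nat) (A : Type) (f : labeled_graph n -> A) :=
  exists t : probing n A, forall G, degree_le D G ->
    exec G t = f G /\ probes G t <= q.

Section Computable.
Variables n D : nat.
Implicit Types G : labeled_graph n.

Lemma computable_cst (A : Type) (a : A) :
  computable D 0 (fun _ : labeled_graph n => a).
Proof. by exists (Return a). Qed.

(** The cost of the second stage depends on the size of the first result, such as the length of a
    ball; the total is checked only at values [f G] that occur. *)
Lemma computable_bind (q1 q : nat) (q2 : nat -> nat) (A B : Type)
    (sz : A -> nat) (f : labeled_graph n -> A) (g : A -> labeled_graph n -> B) :
  computable D q1 f -> (forall a, computable D (q2 (sz a)) (g a)) ->
  (forall G, degree_le D G -> q1 + q2 (sz (f G)) <= q) ->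
  computable D q (fun G => g (f G) G).
Proof.
move=> [t tP] /choice[k kP] le_q; exists (bind t k) => G GD.
have [tE tq] := tP G GD; have [kE kq] := kP (f G) G GD.
rewrite exec_bind probes_bind tE kE; split=> //.
by apply: leq_trans (le_q G GD); apply: leq_add.
Qed.

Lemma computable_bindc (q1 q2 : nat) (A B : Type)
    (f : labeled_graph n -> A) (g : A -> labeled_graph n -> B) :
  computable D q1 f -> (forall a, computable D q2 (g a)) ->
  computable D (q1 + q2) (fun G => g (f G) G).
Proof.
move=> cf cg.
exact: (@computable_bind q1 (q1 + q2) (fun=> q2) A B (fun=> 0) f g).
Qed.

Lemma computable_le (q q' : nat) (A : Type) (f : labeled_graph n -> A) :
  q <= q' -> computable D q f -> computable D q' f.
Proof.
move=> le_q [t tP]; exists t => G GD; have [tE tq] := tP G GD.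
by split=> //; apply: leq_trans le_q.
Qed.

Lemma computable_ext (q : nat) (A : Type) (f g : labeled_graph n -> A) :
  (forall G, degree_le D G -> f G = g G) -> computable D q f ->
  computable D q g.
Proof.
by move=> fg [t tP]; exists t => G GD; rewrite -fg //; apply: tP.
Qed.

Lemma computable_comp (q : nat) (A B : Type) (f : labeled_graph n -> A)
    (h : A -> B) : computable D q f -> computable D q (fun G => h (f G)).
Proof.
move=> cf; rewrite -[q]addn0.
apply: (computable_bindc (g := fun a _ => h a) cf) => a.
exact: computable_cst.
Qed.

Lemma computable_pair (q1 q2 : nat) (A B : Type) (f : labeled_graph n -> A)
    (g : labeled_graph n -> B) :
  computable D q1 f -> computable D q2 g ->
  computable D (q1 + q2) (fun G => (f G, g G)).
Proof.
move=> cf cg; apply: (computable_bindc (g := fun a G => (a, g G)) cf) => a.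
exact: (computable_comp (pair a)).
Qed.

Lemma computable_map (q : nat) (S A : Type) (f : S -> labeled_graph n -> A)
    (s : seq S) :
  (forall x, computable D q (f x)) ->
  computable D (size s * q) (fun G => [seq f x G | x <- s]).
Proof.
move=> cf; elim: s => [|x s IHs]; first exact: computable_cst.
exact: computable_comp (fun p => p.1 :: p.2) (computable_pair (cf x) IHs).
Qed.

(** What is determined by data already probed costs nothing more: choice turns the dependence into a
    function [k], with value [b0] where [f] takes no value. *)
Lemma computable_factor (q : nat) (A B : Type) (b0 : B)
    (f : labeled_graph n -> A) (h : labeled_graph n -> B) :
  computable D q f ->
  (forall G G', degree_le D G -> degree_le D G' -> f G = f G' -> h G = h G') ->
  computable D q h.
Proof.
move=> cf fh.
have /choice[k kP] : forall a, exists b, forall G,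
    degree_le D G -> f G = a -> h G = b.
  move=> a.
  have [[G [GD <-]]|noG] := pselect (exists G, degree_le D G /\ f G = a).
    by exists (h G) => G' GD' /fh ->.
  by exists b0 => G GD fG; case: noG; exists G.
by apply: computable_ext (computable_comp k cf) => G GD; rewrite (kP (f G) G).
Qed.

Lemma computable_nbrs (v : 'I_n) : computable D D (fun G => nbrs G v).
Proof.
have cp i : computable D 1 (fun G => onth (nbrs G v) i).
  exists (Probe v i.+1 (fun o => Return (omap fst o))) => G _ /=.
  by split=> //; case: onth.
have := computable_map (iota 0 D) cp; rewrite size_iota muln1.
move=> /(computable_comp (pmap id)); apply: computable_ext => G GD.
transitivity (pmap (onth (nbrs G v)) (iota 0 D)); first by elim: iota => //= a l ->.
have := GD v; rewrite /deg; elim: (nbrs G v) D => [|x s IHs] [|d] //=.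
- by move=> _; rewrite (iotaDl 1 0); elim: iota.
move=> sd; congr (_ :: _); rewrite -[RHS](IHs d) // (iotaDl 1 0).
by elim: (iota 0 d) => //= a l ->.
Qed.

End Computable.

(** * Balls in the graph *)

Section Ball.
Variable n : nat.
Implicit Types (G : labeled_graph n) (v w x y : 'I_n).

(* A list with repetitions: only its members and a bound on its size matter. *)
Fixpoint ball G (j : nat) v : seq 'I_n :=
  if j is i.+1 then flatten [seq x :: nbrs G x | x <- ball G i v] else [:: v].

Lemma ballSP G j v y :
  reflect (exists2 x, x \in ball G j v & y = x \/ y \in nbrs G x)
          (y \in ball G j.+1 v).
Proof.
apply: (iffP flatten_mapP) => -[x xb].
  by rewrite inE => /orP[/eqP|]; exists x; auto.
by case=> [->|yx]; exists x; rewrite // inE ?eqxx ?yx ?orbT.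
Qed.

Lemma ball_trans G i j x y z :
  y \in ball G i x -> z \in ball G j y -> z \in ball G (i + j) x.
Proof.
move=> xy; elim: j z => [|j IHj] z; first by rewrite addn0 inE => /eqP->.
by rewrite addnS => /ballSP[w /IHj wx wz]; apply/ballSP; exists w.
Qed.

Lemma ball_center G j v : v \in ball G j v.
Proof.
by elim: j => [|j IHj]; rewrite ?mem_head //; apply/ballSP; exists v; auto.
Qed.

Lemma ball_le G i j v : i <= j -> {subset ball G i v <= ball G j v}.
Proof.
by move=> le_ij x xb; rewrite -(subnKC le_ij); apply: ball_trans xb (ball_center _ _ _).
Qed.

Lemma ball_sym G j v w : w \in ball G j v -> v \in ball G j w.
Proof.
elim: j w => [|j IHj] w; first by rewrite !inE eq_sym.
case/ballSP=> x /IHj vx wx; apply: (@ball_trans _ 1 j _ x) => //.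
by apply/ballSP; exists w; rewrite ?mem_head // nbrs_sym; case: wx; auto.
Qed.

Lemma size_ball G D j v : degree_le D G -> size (ball G j v) <= D.+1 ^ j.
Proof.
move=> GD; elim: j => //= j IHj; rewrite expnSr.
apply: leq_trans (leq_mul IHj (leqnn _)); elim: ball => //= x s IHs.
by rewrite size_cat mulSn /= addSn ltnS leq_add // GD.
Qed.

Lemma computable_ball D j v : computable D (D.+1 ^ j) (fun G => ball G j v).
Proof.
(* The centre costs no probe, and this saved unit closes the induction:
   [B - 1 + B * D = B * D.+1 - 1] for [B = D.+1 ^ j]. *)
suff: computable D (D.+1 ^ j).-1 (fun G => ball G j v).
  by apply: computable_le; apply: leq_pred.
elim: j => [|j IHj] /=; first exact: computable_cst.
pose g s G := flatten [seq x :: nbrs G x | x <- s].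
apply: (@computable_bind _ _ _ _ (fun z => z * D) _ _ size _ g IHj) => [s|G GD].
  apply: computable_comp; apply: (computable_map s) => x.
  by apply: (computable_comp (cons x)); apply: computable_nbrs.
have := size_ball j v GD; have := expn_gt0 D.+1 j; rewrite expnS /=; nia.
Qed.

End Ball.

(** * Cole-Vishkin and Linial colour reductions *)

Definition bit (i x : nat) : bool := odd (x %/ 2 ^ i).

Lemma bitS i x : bit i.+1 x = bit i x./2.
Proof. by rewrite /bit expnS divnMA divn2. Qed.

Lemma bit_neq m x y :
  x < 2 ^ m -> y < 2 ^ m -> x <> y -> exists2 i, i < m & bit i x <> bit i y.
Proof.
elim: m x y => [|m IHm] x y.
  by rewrite !ltnS !leqn0 => /eqP-> /eqP->.
rewrite expnS => ltx lty neq.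
have [odd_eq|odd_neq] := eqVneq (odd x) (odd y); last first.
  by exists 0; rewrite // /bit !divn1; apply/eqP.
have [|||i ltim] := IHm x./2 y./2; [lia|lia|lia|].
by rewrite -!bitS; exists i.+1.
Qed.

(** Here [i] is the lowest differing bit; positions below [x + y] suffice, as both numbers are less
    than [2 ^ (x + y)]. The case [x == y] serves fixed points. *)
Definition cole_vishkin (x y : nat) : nat :=
  let i := if x == y then 0
           else find (fun i => bit i x != bit i y) (iota 0 (x + y)) in
  i.*2 + bit i x.

Lemma cole_vishkin_lt m x y :
  0 < m -> x < 2 ^ m -> y < 2 ^ m -> cole_vishkin x y < m.*2.
Proof.
move=> m_gt0 ltx lty; rewrite /cole_vishkin.
have [_|/eqP neq] := eqVneq x y; first by case: bit; lia.
have [i ltim bi] := bit_neq ltx lty neq.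
suff : find (fun i => bit i x != bit i y) (iota 0 (x + y)) <= i.
  by case: bit; lia.
have [le|lt] := leqP (x + y) i.
  by apply: leq_trans (find_size _ _) _; rewrite size_iota.
by rewrite leqNgt; apply: (contraTN _ lt) => /(before_find 0);
   rewrite nth_iota // add0n => /eqP.
Qed.

(** Equal new colours would share both the position and the bit there, but [x] and [y] differ at the
    position chosen for [x]. *)
Lemma cole_vishkin_neq x y z :
  x <> y -> cole_vishkin x y <> cole_vishkin y z.
Proof.
move=> neq; rewrite /cole_vishkin; have [//|_] := eqVneq x y.
set i := find _ _; set j := if _ then _ else _.
have bi : bit i x != bit i y.
  have has_i : has (fun i => bit i x != bit i y) (iota 0 (x + y)).
    have ltx : x < 2 ^ (x + y) by apply: leq_ltn_trans (leq_addr _ _) (ltn_expl _ _).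
    have lty : y < 2 ^ (x + y) by apply: leq_ltn_trans (leq_addl _ _) (ltn_expl _ _).
    have [k ltk bk] := bit_neq ltx lty neq.
    by apply/hasP; exists k; [rewrite mem_iota|apply/eqP].
  have := has_i; rewrite has_find size_iota => lti.
  by have := nth_find 0 has_i; rewrite nth_iota.
move=> eq_ij; have eij : i = j by move: eq_ij; case: bit; case: bit; lia.
by move: eq_ij bi; rewrite -eij; case: bit; case: bit; lia.
Qed.

Section ColeVishkinColor.
Variables (T : Type) (ident : T -> nat).

Fixpoint cv_color (f : T -> T) (t : nat) (v : T) : nat :=
  if t is u.+1 then cole_vishkin (cv_color f u v) (cv_color f u (f v))
  else ident v.

Lemma cv_color_neq f t v :
  (forall u, ident u = ident (f u) -> f u = u) ->
  f v <> v -> cv_color f t v <> cv_color f t (f v).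
Proof.
move=> injf fv; elim: t => [|t IHt] /=; last exact: cole_vishkin_neq.
by move=> /injf.
Qed.

(** After [t] rounds the colour is a function of the first [t.+1] vertices of the path, which bounds
    its probes. *)
Lemma cv_color_traject f g t v :
  traject f v t.+1 = traject g v t.+1 -> cv_color f t v = cv_color g t v.
Proof.
elim: t v => // t IHt v eqt.
have eq1 : traject f v t.+1 = traject g v t.+1.
  by move: eqt; rewrite !(trajectSr _ _ t.+1) => /rcons_inj/(congr1 fst).
have [eqv eq2] : f v = g v /\ traject f (f v) t.+1 = traject g (g v) t.+1.
  by case: eqt => eqv eqt; split; rewrite //= eqt eqv.
by rewrite /= (IHt v) // -eqv IHt // eq2 eqv.
Qed.
End ColeVishkinColor.

Fixpoint tower (j : nat) : nat := if j is i.+1 then 2 ^ tower i else 1.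

Lemma cv_color_lt (T : Type) (ident : T -> nat) (f : T -> T) s :
  (forall v, ident v < tower s) -> forall v, cv_color ident f s v < 8.
Proof.
move=> lt_s; suff H t : t <= s -> forall v,
    cv_color ident f t v < 4 * tower (s - t) + 4.
  by move=> v; have := H s (leqnn s) v; rewrite subnn.
elim: t => [|t IHt] le_ts v /=.
  by have := lt_s v; rewrite subn0; lia.
have tower_gt0 j : 0 < tower j by case: j => //= j; rewrite expn_gt0.
have lt2 w : cv_color ident f t w < 2 ^ (tower (s - t.+1) + 3).
  apply: leq_trans (IHt (ltnW le_ts) w) _; rewrite -subSS subSn //= expnD.
  by have := expn_gt0 2 (tower (s - t.+1)); lia.
have := cole_vishkin_lt _ (lt2 v) (lt2 (f v)).
by have := tower_gt0 (s - t.+1); lia.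
Qed.

(* Linial's colour reduction: a colour is a polynomial of degree less than d
   over a field with more than d^2 elements, and the new colour is a point of
   its graph lying on none of the graphs of the neighbours' polynomials. *)
Lemma linial_reduction d : exists (Q : nat) (lin : seq nat -> seq (seq nat) -> nat),
  [/\ Q <= (2 * (d ^ 2 + 8)) ^ 2,
      forall p s, lin p s < Q &
      forall p q s s', size p = d -> size q = d ->
        (forall i, nth 0 p i < 8) -> (forall i, nth 0 q i < 8) ->
        size s <= d -> size s' <= d -> q \in s -> p \in s' -> p <> q ->
        lin p s <> lin q s'].
Proof.
(* More than [d ^ 2] points leave one available when [d] polynomials exclude at most [d] each, and 8
   elements encode the coefficients. The order of [F] is a power of two above [N] and at most
   [2 * N]. *)
pose N := d ^ 2 + 8.
have [F _ cardF] :=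
  pPrimePowerField (isT : prime 2) (ltn0Sn (trunc_log 2 N)).
have /andP[leN ltN] : 2 ^ trunc_log 2 N <= N < #|F|.
  by rewrite cardF; apply: trunc_log_bounds; rewrite // /N addnS.
pose P (p : seq nat) : {poly F} := (\poly_(i < d) nth 0 (enum F) (nth 0%N p i))%R.
(* A polynomial equal to that of [p] excludes nothing: [s] will contain the colour of the vertex
   itself. *)
pose good p s a := all (fun q => (P q == P p) || ((P q).[a] != (P p).[a])%R) s.
pose point p s : F * F :=
  let a := odflt 0%R [pick a | good p s a] in (a, (P p).[a]%R).
have goodP p s : size s <= d -> good p s (point p s).1.
  move=> sz; rewrite /point /=; case: pickP => //= nogood.
  suff: #|F| <= size s * d by move: ltN; rewrite /N; nia.
  have <- : #|[set a | ~~ good p s a]| = #|F|.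
    by rewrite -cardsT; congr #|pred_of_set _|; apply/setP=> a; rewrite !inE nogood.
  elim: s {sz nogood} => [|q s IHs] /=.
    by rewrite leqn0 cards_eq0; apply/eqP/setP=> a; rewrite !inE.
  have [Pqp|Pqp] := eqVneq (P q) (P p).
    by apply: leq_trans IHs (leq_addl _ _).
  rewrite mulSn; apply: leq_trans (leq_add (leqnn d) IHs).
  pose r := (P q - P p)%R.
  apply: leq_trans (_ : #|[set a | root r a] :|: [set a | ~~ good p s a]| <= _).
    apply/subset_leq_card/subsetP=> a; rewrite !inE negb_and negbK.
    by rewrite rootE /r !hornerE GRing.subr_eq0.
  apply: leq_trans (leq_card_setU _ _) _; rewrite leq_add2r cardE.
  have /max_poly_roots/(_ _ (enum_uniq [set a | root r a])) : r != 0%R.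
    by rewrite GRing.subr_eq0.
  move=> /(_ _)/ltnW/leq_trans; apply.
    by apply/allP=> a; rewrite mem_enum inE.
  apply: leq_trans (size_polyD _ _) _; rewrite size_polyN.
  by rewrite geq_max !size_poly.
exists #|{: F * F}|, (fun p s => nat_of_ord (enum_rank (point p s))); split.
- by rewrite card_prod -mulnn leq_mul // cardF expnS leq_mul2l.
- by move=> p s.
move=> p q s s' szp szq p8 q8 szs szs' qs ps' neq /val_inj/enum_rank_inj eq_pt.
have Pneq : P q != P p.
  apply/eqP=> /polyP Peq; apply: neq; apply: (@eq_from_nth _ 0); rewrite szp //.
  move=> i ltid; have := Peq i; rewrite !coef_poly ltid => /eqP.
  have lt8 j : j < 8 -> j < size (enum F).
    move=> j8; rewrite -cardE (leq_trans j8) //.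
    by rewrite ltnW // (leq_ltn_trans _ ltN) ?leq_addl.
  by rewrite nth_uniq ?enum_uniq ?lt8 // => /eqP.
have /allP/(_ q qs) := goodP p s szs.
rewrite (negPf Pneq) orFb -[(P p).[_]%R]/(point p s).2 eq_pt.
by rewrite -[(point q s').2]/((P q).[_]%R) eqxx.
Qed.

(** * Colouring a power of the graph *)

Section Coloring.
Variables (n D R s : nat).
Implicit Types (G : labeled_graph n) (v w : 'I_n).

(** Past the end of the ball the default makes [v] a fixed point. *)
Definition ball_nth G (i : nat) v : 'I_n := nth v (ball G R v) i.

(* The edges from each v to the i-th member of its ball form a functional
   graph, in which s rounds of Cole-Vishkin only look at a path of length s;
   together the D.+1 ^ R graphs cover the R-th power of G. *)
Definition cv_vector G v : seq nat :=
  mkseq (fun i => cv_color (@nat_of_ord n) (ball_nth G i) s v) (D.+1 ^ R).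

(** The coordinate at the position of [w] in the ball of [v] comes from a functional graph sending
    [v] to [w], so it separates them. *)
Lemma cv_vector_neq G v w : degree_le D G ->
  w \in ball G R v -> v <> w -> cv_vector G v <> cv_vector G w.
Proof.
move=> GD wv neq /(congr1 (fun x => nth 0 x (index w (ball G R v)))).
have lti : index w (ball G R v) < size (ball G R v) by rewrite index_mem.
rewrite !nth_mkseq; try by apply: leq_trans lti (size_ball _ _ GD).
set f := ball_nth _ _; have <- : f v = w by rewrite /f /ball_nth nth_index.
apply: cv_color_neq => [u /val_inj //|]; rewrite /f /ball_nth nth_index //.
exact: nesym.
Qed.

Lemma cv_vector_lt8 G v i : n <= tower s -> nth 0 (cv_vector G v) i < 8.
Proof.
move=> le_n; have [lti|gei] := ltnP i (D.+1 ^ R).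
  rewrite nth_mkseq //; apply: cv_color_lt => w; exact: leq_trans le_n.
by rewrite nth_default // size_mkseq.
Qed.

Lemma computable_cv_vector v :
  computable D (D.+1 ^ R * (s.+1 * D.+1 ^ R)) (fun G => cv_vector G v).
Proof.
have -> : D.+1 ^ R * (s.+1 * D.+1 ^ R) =
    size (iota 0 (D.+1 ^ R)) * (s.+1 * D.+1 ^ R) by rewrite size_iota.
apply: computable_map => i.
have ct t : forall v, computable D (t * D.+1 ^ R)
    (fun G => traject (ball_nth G i) v t).
  elim: t => [|t IHt] w; first exact: computable_cst.
  rewrite mulSn /=; apply: (computable_comp (cons w)).
  apply: (computable_bindc (f := fun G => ball_nth G i w)
     (g := fun x G => traject (ball_nth G i) x t)) => //.
  exact: (computable_comp (fun b => nth w b i) (computable_ball _ _ _)).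
apply: (computable_factor 0 (ct s.+1 v)) => G G' _ _.
exact: cv_color_traject.
Qed.

Lemma local_coloring : n <= tower s ->
  exists (Q : nat) (col : labeled_graph n -> 'I_n -> nat),
  [/\ Q <= (2 * ((D.+1 ^ R) ^ 2 + 8)) ^ 2,
      forall G v, col G v < Q,
      forall G v w, degree_le D G -> w \in ball G R v -> v <> w ->
        col G v <> col G w &
      forall v, computable D
        (D.+1 ^ R + (D.+1 ^ R).+1 * (D.+1 ^ R * (s.+1 * D.+1 ^ R)))
        (fun G => col G v)].
Proof.
move=> le_n; have [Q [lin [leQ ltQ linP]]] := linial_reduction (D.+1 ^ R).
exists Q, (fun G v => lin (cv_vector G v) [seq cv_vector G w | w <- ball G R v]).
split=> // [G v w GD wv neq|v].
  apply: linP; rewrite ?size_mkseq ?size_map ?size_ball //.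
  - by move=> i; apply: cv_vector_lt8.
  - by move=> i; apply: cv_vector_lt8.
  - exact: map_f.
  - by apply/map_f/ball_sym.
  - exact: cv_vector_neq.
pose q := D.+1 ^ R * (s.+1 * D.+1 ^ R).
pose g b G := lin (cv_vector G v) [seq cv_vector G w | w <- b].
apply: (computable_bind (f := fun G => ball G R v) (g := g) (sz := size)
  (q2 := fun z => q + z * q) (computable_ball _ _ _)) => [b|G GD].
  apply: (computable_comp (f := fun G => (cv_vector G v, map (cv_vector G) b))
    (fun x => lin x.1 x.2)).
  apply: computable_pair; first exact: computable_cv_vector.
  by apply: computable_map => w; apply: computable_cv_vector.
by rewrite leq_add2l mulSn leq_add2l leq_mul2r size_ball ?orbT.
Qed.

End Coloring.

(** * Matchings as involutions and their local improvements *)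

(* A matching, seen as the involution exchanging the ends of its edges. *)
Definition pairing (n : nat) (G : labeled_graph n) (m : 'I_n -> 'I_n) :=
  involutive m /\ forall x, m x != x -> m x \in nbrs G x.

Definition unmatched (n : nat) (m : 'I_n -> 'I_n) : {set 'I_n} := [set x | m x == x].

Definition augment (n : nat) (m p : 'I_n -> 'I_n) (x : 'I_n) : 'I_n :=
  if p x == x then m x else p x.

(** As [m] preserves the support of [p], each edge of [m] either survives or has both ends rematched
    by [p]. *)
Lemma pairing_augment (n : nat) (G : labeled_graph n) (m p : 'I_n -> 'I_n) :
  pairing G m -> pairing G p -> (forall x, p x != x -> p (m x) != m x) ->
  pairing G (augment m p).
Proof.
move=> [mK mG] [pK pG] pm; split=> x; rewrite /augment; last first.
  by case: ifP => [_ /mG|/negbT /pG].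
have [px|px] := eqVneq (p x) x; last by rewrite pK eq_sym (negPf px).
case: eqVneq => [//|/pm]; by rewrite mK px eqxx.
Qed.

Lemma unmatched_augment (n : nat) (m p : 'I_n -> 'I_n) :
  unmatched (augment m p) = unmatched m :\: [set x | p x != x].
Proof.
apply/setP=> x; rewrite !inE /augment negbK.
by case: (eqVneq (p x) x) => // /negPf.
Qed.

Section Improvement.
Variables (n : nat).
Implicit Types (G : labeled_graph n) (m : 'I_n -> 'I_n) (L : seq 'I_n).

(** Instead of a path, [p] is the matching to install inside [L]. Its support is stable under [m]
    and contains a free vertex, so no vertex is freed and at least one is newly matched. *)
Definition improving G m L (p : {ffun 'I_n -> 'I_n}) : bool :=
  [&& [forall x, p (p x) == x],
      [forall x, (p x != x) ==> [&& x \in L, p x \in nbrs G x & p (m x) != m x]]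
    & [exists x, (p x != x) && (m x == x)]].

Lemma improvingP G m L (p : {ffun 'I_n -> 'I_n}) :
  reflect [/\ pairing G p, forall x, p x != x -> x \in L,
              forall x, p x != x -> p (m x) != m x &
              exists2 x, p x != x & m x = x] (improving G m L p).
Proof.
apply: (iffP and3P) => [[/forallP pK /forallP pL /existsP[x /andP[px /eqP mx]]]|].
  split; last (by exists x); last 2 first.
  - by move=> y py; have := pL y; rewrite py => /and3P[].
  - by move=> y py; have := pL y; rewrite py => /and3P[].
  split=> y; first exact/eqP/pK.
  by move=> py; have := pL y; rewrite py => /and3P[].
case=> [[pK pG] pL pm [x px mx]]; split.
- by apply/forallP=> y; rewrite pK.
- apply/forallP=> y; apply/implyP=> py.
  by apply/and3P; split; [apply: pL|apply: pG|apply: pm].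
- by apply/existsP; exists x; rewrite px mx eqxx.
Qed.

Lemma improving_local G G' m m' L p :
  {in L, nbrs G =1 nbrs G'} -> {in L, m =1 m'} ->
  improving G m L p -> improving G' m' L p.
Proof.
move=> eqG eqm /improvingP[[pK pG] pL pm [x px mx]]; apply/improvingP; split=> //.
- by split=> // y py; rewrite -eqG ?pG ?pL.
- by move=> y py; rewrite -eqm ?pm ?pL.
- by exists x; rewrite // -eqm ?pL.
Qed.

Definition improvement G m L : {ffun 'I_n -> 'I_n} :=
  odflt [ffun x => x] [pick p | improving G m L p].

Lemma improvement_local G G' m m' L :
  {in L, nbrs G =1 nbrs G'} -> {in L, m =1 m'} ->
  improvement G m L = improvement G' m' L.
Proof.
move=> eqG eqm; rewrite /improvement (eq_pick (Q := improving G' m' L)) // => p.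
by apply/idP/idP; apply: improving_local => x xL; rewrite ?eqG ?eqm.
Qed.

Lemma improvement_improving G m L x :
  improvement G m L x != x -> improving G m L (improvement G m L).
Proof. by rewrite /improvement; case: pickP => //=; rewrite ffunE eqxx. Qed.

Lemma improving_improvement G m L p :
  improving G m L p -> improving G m L (improvement G m L).
Proof. by rewrite /improvement; case: pickP => //= + ip => /(_ p); rewrite ip. Qed.

End Improvement.

Lemma leq_card_bigcup (T I : finType) (A : {set I}) (B : I -> {set T}) K :
  (forall i, #|B i| <= K) -> #|\bigcup_(i in A) B i| <= #|A| * K.
Proof.
move=> leK; rewrite -sum_nat_const; elim/big_rec2: _ => [|i x y _ le_xy].
  by rewrite cards0.
by apply: leq_trans (leq_card_setU _ _) (leq_add (leK i) le_xy).
Qed.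

(** * Sweeps over the colour classes *)

Section Sweep.
Variables (n r Q : nat) (col : labeled_graph n -> 'I_n -> nat).
Implicit Types (G : labeled_graph n) (m : 'I_n -> 'I_n).

(** When colours are proper up to distance [r + r], the ball of [x] contains at most one vertex of
    colour [c], so [ohead] makes no real choice. *)
Definition center G (c : nat) (x : 'I_n) : option 'I_n :=
  ohead [seq v <- ball G r x | col G v == c].

Definition patch G m (c : nat) (x : 'I_n) : 'I_n :=
  if center G c x is Some v then improvement G m (ball G r v) x else x.

Fixpoint matched G (t : nat) : 'I_n -> 'I_n :=
  if t is u.+1 then augment (matched G u) (patch G (matched G u) (u %% Q))
  else id.

Variable G : labeled_graph n.
Hypothesis col_lt : forall v, col G v < Q.
Hypothesis col_proper :
  forall v w, w \in ball G (r + r) v -> v <> w -> col G v <> col G w.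

Lemma patch_center m v x :
  x \in ball G r v -> patch G m (col G v) x = improvement G m (ball G r v) x.
Proof.
move=> xv; rewrite /patch /center.
have : v \in [seq w <- ball G r x | col G w == col G v].
  by rewrite mem_filter eqxx ball_sym.
case Es: [seq _ <- _ | _] => [//|w s] _ /=.
have : w \in [seq w <- ball G r x | col G w == col G v].
  by rewrite Es mem_head.
rewrite mem_filter => /andP[/eqP cw wx]; congr (improvement _ _ (ball _ _ _) _).
apply/eqP/negPn/negP => /eqP neq; apply: (col_proper _ (nesym neq)) => //.
exact: ball_trans wx.
Qed.

Lemma patchP m c x : patch G m c x != x ->
  exists v, [/\ c = col G v, x \in ball G r v &
    improving G m (ball G r v) (improvement G m (ball G r v))].
Proof.
rewrite /patch /center; case Es: [seq _ <- _ | _] => [|w s] /=; first by rewrite eqxx.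
have : w \in [seq w <- ball G r x | col G w == c] by rewrite Es mem_head.
rewrite mem_filter => /andP[/eqP cw wx] /improvement_improving imp.
by exists w; split=> //; apply: ball_sym.
Qed.

(** Around any vertex it moves, the patch agrees on a whole ball with the improvement of a single
    centre, whose support lies in that ball and is stable under [m]. *)
Lemma pairing_step m c : pairing G m -> pairing G (augment m (patch G m c)).
Proof.
move=> mG; apply: pairing_augment => //; last first.
  move=> x px; have [v [Ec xv imp]] := patchP px; move: px.
  have /improvingP[_ pL pm _] := imp; rewrite Ec patch_center // => px.
  by rewrite patch_center ?pL ?pm.
split=> x; last first.
  move=> px; have [v [Ec xv imp]] := patchP px; move: px.
  by have /improvingP[[_ pG] _ _ _] := imp; rewrite Ec patch_center // => /pG.
have [px|px] := eqVneq (patch G m c x) x; first by rewrite !px.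
have [v [Ec xv imp]] := patchP px; move: px.
have /improvingP[[pK _] pL _ _] := imp; rewrite Ec (patch_center _ xv) => px.
by rewrite patch_center ?pK // pL // pK eq_sym.
Qed.

Lemma pairing_matched t : pairing G (matched G t).
Proof.
elim: t => [|t IHt] /=; last exact: pairing_step.
by split=> // x; rewrite eqxx.
Qed.

Lemma unmatched_le t u : t <= u -> unmatched (matched G u) \subset unmatched (matched G t).
Proof.
move=> /subnKC <-; elim: (u - t) => [|i IHi]; rewrite ?addn0 // addnS.
by apply: subset_trans IHi; rewrite /= unmatched_augment subsetDl.
Qed.

Lemma patch_near m c x : patch G m c x != x ->
  exists2 y, y \in unmatched m :\: unmatched (augment m (patch G m c)) &
             x \in ball G (r + r) y.
Proof.
move=> px; have [v [Ec xv imp]] := patchP px.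
have /improvingP[_ pL _ [y py my]] := imp; exists y.
  by rewrite unmatched_augment !inE Ec patch_center ?pL // py my eqxx.
by apply: (ball_trans (y := v)) => //; apply/ball_sym/pL.
Qed.

(** Either the matching on the ball of [v] is unchanged when the turn of [v] comes, and [v] then
    augments, or an earlier patch touched this ball; in both cases a vertex nearby gets matched. *)
Lemma sweep_near t v p : Q %| t ->
  improving G (matched G t) (ball G r v) p ->
  exists2 y, y \in unmatched (matched G t) :\: unmatched (matched G (t + Q)) &
             v \in ball G (r + r + r) y.
Proof.
move=> Qt imp; set F := _ :\: _.
have FP u y : t <= u < t + Q ->
    y \in unmatched (matched G u) :\: unmatched (matched G u.+1) -> y \in F.
  case/andP=> tu uQ; rewrite !in_setD => /andP[yu1 yu].
  rewrite (subsetP (unmatched_le tu)) // andbT.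
  by apply: contra yu1; apply/subsetP/unmatched_le.
have [/existsP[y /andP[yF vy]]|] :=
  boolP [exists y, (y \in F) && (v \in ball G (r + r + r) y)]; first by exists y.
rewrite negb_exists => /forallP noF; exfalso.
have noP y : y \in F -> v \in ball G (r + r + r) y -> False.
  by move=> yF vy; have := noF y; rewrite yF vy.
have same c : c <= col G v ->
    {in ball G r v, matched G t =1 matched G (t + c)}.
  elim: c => [|c IHc] lec x xv; first by rewrite addn0.
  rewrite addnS /= /augment; case: eqVneq => [_|px]; first exact: IHc (ltnW lec) x xv.
  have [y yF xy] := patch_near px; exfalso; apply: (noP y).
    by apply: FP yF; rewrite leq_addr ltn_add2l (ltn_trans lec).
  by apply: ball_trans xy _; apply: ball_sym.
have := improving_improvement (improving_local (fun x _ => erefl) (same _ (leqnn _)) imp).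
move=> /improvingP[_ pL _ [y py my]].
apply: (noP y); last first.
  by apply: ball_le (ball_sym (pL _ py)); lia.
apply: (FP (t + col G v)); first by rewrite leq_addr ltn_add2l col_lt.
rewrite /= unmatched_augment !inE my eqxx.
have -> : (t + col G v) %% Q = col G v.
  by rewrite -modnDml (eqP Qt) add0n modn_small.
by rewrite patch_center ?pL // py.
Qed.

(** Each vertex newly matched in the sweep accounts for at most the vertices of its ball of radius
    [3 * r], and these balls cover [A]. *)
Lemma sweep_progress D t (A : {set 'I_n}) : degree_le D G -> Q %| t ->
  (forall v, v \in A -> exists p, improving G (matched G t) (ball G r v) p) ->
  #|A| + D.+1 ^ (3 * r) * #|unmatched (matched G (t + Q))| <=
    D.+1 ^ (3 * r) * #|unmatched (matched G t)|.
Proof.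
move=> GD Qt impA.
have sub := unmatched_le (leq_addr Q t).
rewrite -(cardsID (unmatched (matched G (t + Q))) (unmatched (matched G t))).
rewrite (setIidPr sub) mulnDr addnC leq_add2l mulnC.
have -> : 3 * r = r + r + r by lia.
pose B y := [set v in ball G (r + r + r) y].
apply: leq_trans (leq_card_bigcup (B := B) _ _) => [|y]; last first.
  rewrite cardsE; apply: leq_trans (card_size _) (size_ball _ _ GD).
apply/subset_leq_card/subsetP=> v /impA[p /(sweep_near Qt)[y yF vy]].
by apply/bigcupP; exists y; rewrite // inE.
Qed.

End Sweep.

Lemma pairing_ball (n : nat) (G : labeled_graph n) (m : 'I_n -> 'I_n) j v x :
  pairing G m -> x \in ball G j v -> m x \in ball G j.+1 v.
Proof.
move=> [_ mG] xv; apply/ballSP; exists x => //.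
by have [->|/mG] := eqVneq (m x) x; auto.
Qed.

(** * Counting short augmenting walks *)

(* From an m-free vertex, follow edges of s and m alternately.  The walk stops
   at a vertex free for s, or at one free for m, in which case it is augmenting. *)
Section AlternatingWalk.
Variables (n k : nat) (G : labeled_graph n) (m s : 'I_n -> 'I_n).
Hypotheses (mG : pairing G m) (sG : pairing G s).

Definition walk (i : nat) (v : 'I_n) : 'I_n := iter i (fun x => m (s x)) v.

Definition s_end i v := s (walk i v) == walk i v.
Definition m_end i v := m (s (walk i v)) == s (walk i v).

Definition short_augmenting (v : 'I_n) : bool :=
  (m v == v) && [exists j : 'I_k, m_end j v &&
    [forall i : 'I_k, (i <= j) ==> ~~ s_end i v]].

Lemma walk_ball i v : walk i v \in ball G (2 * i) v.
Proof.
elim: i => [|i IHi]; rewrite ?mem_head // mulnSr addn2.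
exact: pairing_ball mG (pairing_ball sG IHi).
Qed.

(** The set [P] of vertices visited up to the end at [j] is stable under [s] and under [m], because
    both extremities are [m]-free. Restricting [s] to [P] gives the improvement. *)
Lemma short_augmenting_improving v : short_augmenting v ->
  exists p, improving G m (ball G (2 * k) v) p.
Proof.
case/andP=> /eqP mv /existsP[j /andP[/eqP jend /forallP jrun]].
have {}jrun i : i <= j -> s (walk i v) != walk i v.
  by move=> ij; have := jrun (Ordinal (leq_ltn_trans ij (ltn_ord j))); rewrite /= ij.
have [mK _] := mG; have [sK sN] := sG.
pose P := [pred x | [exists i : 'I_k,
  (i <= j) && ((x == walk i v) || (x == s (walk i v)))]].
have PP x : reflect (exists2 i, i <= j & x = walk i v \/ x = s (walk i v)) (P x).
  apply: (iffP existsP) => [[i /andP[ij /orP[]/eqP]]|[i ij xi]].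
  - by exists i; auto.
  - by exists i; auto.
  exists (Ordinal (leq_ltn_trans ij (ltn_ord j))); rewrite ij /=.
  by case: xi => ->; rewrite eqxx ?orbT.
have sP x : P x -> P (s x) /\ s x != x.
  case/PP=> i ij [->|->]; rewrite ?sK; split.
  - by apply/PP; exists i; auto.
  - exact: jrun.
  - by apply/PP; exists i; auto.
  - by rewrite eq_sym jrun.
have mP x : P x -> P (m x).
  case/PP=> i ij [->|->].
    case: i ij => [|i] ij; first by rewrite /= mv; apply/PP; exists 0; auto.
    by rewrite /= mK; apply/PP; exists i; [apply: ltnW|right].
  have [ij'|ij'] := ltnP i j; first by apply/PP; exists i.+1; auto.
  have -> : i = j by apply/eqP; rewrite eqn_leq ij ij'.
  by rewrite jend; apply/PP; exists j; auto.
pose p := [ffun x => if P x then s x else x].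
have pP x : (p x != x) = P x.
  by rewrite ffunE; have [/sP[_ ->]|] := boolP (P x); rewrite ?eqxx.
exists p; apply/improvingP; split.
- split=> x; last first.
    by rewrite pP => Px; rewrite ffunE Px; apply: sN; case: (sP x Px).
  rewrite ffunE [p x]ffunE; have [Px|/negPf Px] := boolP (P x); last by rewrite Px.
  by case: (sP x Px) => -> _; rewrite sK.
- move=> x; rewrite pP => /PP[i ij xi].
  have ik : i < k by apply: leq_ltn_trans ij _.
  by case: xi => ->; [apply: ball_le (walk_ball i v)
    |apply: ball_le (pairing_ball sG (walk_ball i v))]; lia.
- by move=> x; rewrite !pP; apply: mP.
- by exists v; rewrite // pP; apply/PP; exists 0; auto.
Qed.

(** One step of the walk is injective, so meeting walks can be traced back together. Unequal times
    would place an [m]-free start inside the other walk, which would have ended just before. *)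
Lemma walk_inj i j v w : m v = v -> m w = w ->
  (forall l, l < i -> ~~ m_end l v) -> (forall l, l < j -> ~~ m_end l w) ->
  walk i v = walk j w -> i = j /\ v = w.
Proof.
have [mK _] := mG; have [sK _] := sG.
have injg : injective (fun x => m (s x)) by apply: inj_comp; apply: inv_inj.
have inj_walk a : injective (walk a).
  by elim: a => [|a IHa] x y //= /injg/IHa.
have lt_absurd a b x y : m x = x -> (forall l, l < b -> ~~ m_end l y) ->
    a < b -> walk a x <> walk b y.
  move=> mx runy lt_ab; rewrite -(subnKC (ltnW lt_ab)) [walk (_ + _) _]iterD.
  move=> /inj_walk; have [l El] : {l | b - a = l.+1}.
    by case: (b - a) (subn_gt0 a b) => [|l]; [rewrite lt_ab|exists l].
  rewrite El /= => xE; have /negP[] := runy l ltac:(lia).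
  have sE : s (walk l y) = x by rewrite -[s _]mK -xE mx.
  by rewrite /m_end sE mx.
move=> mv mw runv runw eq_vw; have [lt|lt|eq_ij] := ltngtP i j.
- by case: (lt_absurd _ _ _ _ mv runw lt).
- by case: (lt_absurd _ _ _ _ mw runv lt).
by split=> //; move: eq_vw; rewrite eq_ij => /inj_walk.
Qed.

(** A walk that is not short augmenting either stops at an [s]-free vertex ([A]) or runs for [k]
    steps ([B]). Walks do not meet, so [A] injects into the [s]-free vertices by end points, and [B]
    times [k] into the [s]-matched ones by all positions. *)
Lemma card_short_augmenting :
  k * #|unmatched m| <= k * #|[set v | short_augmenting v]|
                   + (k * #|unmatched s| + #|~: unmatched s|).
Proof.
pose runs (i : nat) v := [forall l : 'I_k, (l < i) ==> ~~ m_end l v].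
have runsP i v : i <= k -> runs i v -> forall l, l < i -> ~~ m_end l v.
  move=> ik /forallP run l li.
  by have := run (Ordinal (leq_trans li ik)); rewrite /= li.
pose A := [set v in unmatched m | [exists i : 'I_k, s_end i v && runs i v]].
pose B := [set v in unmatched m | [forall i : 'I_k, ~~ s_end i v && ~~ m_end i v]].
have cardA : #|A| <= #|unmatched s|.
  pose stop v := [pick i : 'I_k | s_end i v && runs i v].
  pose f v := if stop v is Some i then walk i v else v.
  have stopA v : v \in A ->
      exists2 i : 'I_k, f v = walk i v & s_end i v && runs i v.
    rewrite inE /f /stop => /andP[_ /existsP[i si]].
    by case: pickP => [i' ?|/(_ i)]; [exists i'|rewrite si].
  have injf : {in A &, injective f}.
    move=> v w vA wA; have [i -> /andP[_ ri]] := stopA v vA.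
    have [j -> /andP[_ rj]] := stopA w wA.
    move: vA wA; rewrite !inE => /andP[/eqP mv _] /andP[/eqP mw _].
    move=> /(walk_inj mv mw (runsP _ _ (ltnW (ltn_ord i)) ri)).
    by move=> /(_ (runsP _ _ (ltnW (ltn_ord j)) rj)) [].
  rewrite -(card_in_imset injf); apply/subset_leq_card/subsetP.
  by move=> _ /imsetP[v vA ->]; have [i -> /andP[si _]] := stopA v vA; rewrite inE.
have cardB : k * #|B| <= #|~: unmatched s|.
  pose f (vi : 'I_n * 'I_k) := walk vi.2 vi.1.
  have injf : {in setX B [set: 'I_k] &, injective f}.
    move=> [v i] [w j]; rewrite /f !inE !andbT /=.
    move=> /andP[/eqP mv /forallP Bv] /andP[/eqP mw /forallP Bw] eq_vw.
    have run (x : 'I_n) (l : 'I_k) :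
        (forall i : 'I_k, ~~ s_end i x && ~~ m_end i x) ->
        forall l', l' < l -> ~~ m_end l' x.
      by move=> Bx l' /ltn_trans/(_ (ltn_ord l)) lk;
         have /andP[] := Bx (Ordinal lk).
    have [/val_inj -> -> //] := walk_inj mv mw (run v i Bv) (run w j Bw) eq_vw.
  have := card_in_imset injf; rewrite cardsX cardsT card_ord mulnC => <-.
  apply/subset_leq_card/subsetP=> _ /imsetP[[v i] vB ->].
  move: vB; rewrite !inE andbT /f /= => /andP[_ /forallP/(_ i)].
  by case/andP.
have sub : unmatched m \subset [set v | short_augmenting v] :|: A :|: B.
  apply/subsetP=> v vm; rewrite !inE; move: (vm); rewrite inE => mv.
  have [_|] := boolP [forall i : 'I_k, ~~ s_end i v && ~~ m_end i v].
    by rewrite mv !orbT.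
  rewrite negb_forall andbF orbF => /existsP[i0 si0].
  have exi : exists i, (i < k) && (s_end i v || m_end i v).
    by exists i0; rewrite ltn_ord -[_ || _]negbK negb_or.
  case: (ex_minnP exi) => i /andP[ik si] min_i.
  have before l : l < i -> ~~ s_end l v && ~~ m_end l v.
    move=> li; rewrite -negb_or; apply/negP=> sl.
    by have := min_i l; rewrite sl (ltn_trans li ik) leqNgt li => /(_ isT).
  apply/orP; have [se|se] := boolP (s_end i v).
    right; rewrite mv /=; apply/existsP; exists (Ordinal ik); rewrite /= se.
    by apply/forallP=> l; apply/implyP=> /before/andP[].
  left; rewrite /short_augmenting mv; apply/existsP; exists (Ordinal ik).
  rewrite /=; move: si; rewrite (negPf se) /= => ->.
  apply/forallP=> l; apply/implyP; rewrite leq_eqVlt => /orP[/eqP-> //|].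
  by move=> /before/andP[].
have le_sum : #|unmatched m| <= #|[set v | short_augmenting v]| + #|A| + #|B|.
  apply: leq_trans (subset_leq_card sub) _.
  apply: leq_trans (leq_card_setU _ _) _.
  by rewrite leq_add2r leq_card_setU.
apply: leq_trans (leq_mul (leqnn k) le_sum) _; rewrite !mulnDr addnA.
by rewrite !leq_add // leq_mul.
Qed.

End AlternatingWalk.

Lemma sweeps_approximate (n D k Q : nat) (col : labeled_graph n -> 'I_n -> nat)
    (G : labeled_graph n) (s : 'I_n -> 'I_n) :
  0 < k -> degree_le D G -> (forall v, col G v < Q) ->
  (forall v w, w \in ball G (2 * k + 2 * k) v -> v <> w -> col G v <> col G w) ->
  pairing G s ->
  let m := matched (2 * k) Q col G (D.+1 ^ (3 * (2 * k)) * k * Q) in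
  k * (#|unmatched m| - #|unmatched s|) <= 2 * #|~: unmatched s|.
Proof.
move=> k_gt0 GD col_lt col_proper sG /=.
set K := D.+1 ^ _; pose mt i := matched (2 * k) Q col G (i * Q).
pose f i := #|unmatched (mt i)|; set fs := #|unmatched s|.
set a := #|~: unmatched s|.
have fsa : fs + a = n by rewrite cardsC card_ord.
(* While the bound fails, [k * #|A|] exceeds [a], so each sweep lowers [K * k * f i] by at least
   [a.+1]. After [K * k] sweeps this would give [f + a.+1 <= n = fs + a], hence [f < fs], and the
   truncated difference vanishes. *)
suff H i : k * (f i - fs) <= 2 * a \/ i * a.+1 + K * k * f i <= K * k * n.
  have [//|le_n] := H (K * k); rewrite -/(mt _) -/(f _).
  have K_gt0 : 0 < K * k by rewrite muln_gt0 k_gt0 expn_gt0.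
  by move: le_n; rewrite -mulnDr leq_pmul2l // => le_n; rewrite (_ : f _ - fs = 0); lia.
elim: i => [|i [done|IHi]].
- by right; rewrite mul0n add0n leq_mul2l (leq_trans (max_card _)) ?card_ord ?orbT.
- left; apply: leq_trans done; rewrite leq_mul2l leq_sub2r ?orbT //.
  by apply/subset_leq_card/unmatched_le; rewrite leq_mul2r leqnSn orbT.
have [le_a|gt_a] := leqP (k * (f i - fs)) (2 * a); first left.
  apply: leq_trans le_a; rewrite leq_mul2l leq_sub2r ?orbT //.
  by apply/subset_leq_card/unmatched_le; rewrite leq_mul2r leqnSn orbT.
right.
have mG : pairing G (mt i) by apply: pairing_matched.
pose A := [set v | short_augmenting k (mt i) s v].
have prog : #|A| + K * f i.+1 <= K * f i.
  have := sweep_progress (A := A) col_lt col_proper GD (dvdn_mull i (dvdnn Q)).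
  rewrite /f /mt [i.+1 * Q]mulSnr; apply => v.
  by rewrite inE; apply: short_augmenting_improving.
have := card_short_augmenting k mG sG; rewrite -/A -/(f i) -/fs -/a => cnt.
have kprog : k * #|A| + K * k * f i.+1 <= K * k * f i.
  by have := leq_mul (leqnn k) prog; rewrite mulnDr !mulnA [k * K]mulnC.
rewrite mulSn; move: gt_a; rewrite mulnBr.
by move: (f i) (f i.+1) IHi cnt kprog => x y; lia.
Qed.

(** * Passing between edge sets and involutions *)

Section EdgeSets.
Variables (n : nat) (G : labeled_graph n).
Implicit Types (M : {set {set 'I_n}}) (m : 'I_n -> 'I_n).

Lemma card_edge (e : {set 'I_n}) : e \in edges G -> #|e| = 2.
Proof.
rewrite inE => /existsP[u /existsP[v /andP[vu /eqP->]]].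
rewrite cards2; case: eqVneq vu => // ->.
by rewrite (negPf (nbrs_irrefl _ _)).
Qed.

Lemma card_cover_matching M : matching G M -> #|cover M| = 2 * #|M|.
Proof.
move=> [/subsetP ME tM]; have := leq_card_cover M; rewrite tM.
move=> [_ /eqP->]; rewrite (eq_bigr (fun=> 2)); first by rewrite sum_nat_const mulnC.
by move=> e /ME/card_edge.
Qed.

Definition pairing_of M (x : 'I_n) : 'I_n :=
  odflt x [pick y | (y != x) && ([set x; y] \in M)].

Lemma matching_eq M x y z : matching G M ->
  [set x; y] \in M -> [set x; z] \in M -> z != x -> y = z.
Proof.
move=> [_ /trivIsetP tM] xy xz zx; have [eqs|neq] := eqVneq [set x; y] [set x; z].
  by have := set22 x z; rewrite -eqs !inE (negPf zx) => /eqP.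
have /disjoint_setI0/setP/(_ x) := tM _ _ xy xz neq.
by rewrite !inE eqxx.
Qed.

Lemma pairing_ofE M x y : matching G M ->
  y != x -> [set x; y] \in M -> pairing_of M x = y.
Proof.
move=> MG yx xy; rewrite /pairing_of; case: pickP => [z /andP[zx xz]|/(_ y)] /=.
  exact: matching_eq xz xy yx.
by rewrite yx xy.
Qed.

Lemma pairing_ofP M x : pairing_of M x != x -> [set x; pairing_of M x] \in M.
Proof. by rewrite /pairing_of; case: pickP => [y /andP[]|] //=; rewrite eqxx. Qed.

Lemma mem_edges u v : ([set u; v] \in edges G) = (v \in nbrs G u).
Proof.
rewrite inE; apply/existsP/idP => [[x /existsP[y /andP[yx /eqP uv]]]|vu]; last first.
  by exists u; apply/existsP; exists v; rewrite vu eqxx.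
have nxy : x != y by apply: contraTneq yx => ->; apply: nbrs_irrefl.
have := set21 u v; rewrite uv !inE => /orP[]/eqP uE.
  have := set22 x y; rewrite -uv !inE uE eq_sym (negPf nxy) => /eqP <-.
  by [].
have := set21 x y; rewrite -uv !inE uE (negPf nxy) => /eqP <-.
by rewrite nbrs_sym.
Qed.

Lemma pairing_pairing_of M : matching G M -> pairing G (pairing_of M).
Proof.
move=> MG; split=> x; last first.
  by move/pairing_ofP/(subsetP MG.1); rewrite mem_edges.
have [px|px] := eqVneq (pairing_of M x) x; first by rewrite !px.
by apply: pairing_ofE => //; rewrite 1?eq_sym // setUC pairing_ofP.
Qed.

Lemma card_unmatched_pairing_of M : matching G M ->
  #|~: unmatched (pairing_of M)| = 2 * #|M|.
Proof.
move=> MG; rewrite -card_cover_matching //; congr #|pred_of_set _|.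
apply/setP=> x; rewrite !inE; apply/idP/bigcupP => [px|[e eM xe]].
  by exists [set x; pairing_of M x]; rewrite ?pairing_ofP // set21.
have := subsetP MG.1 e eM.
rewrite inE => /existsP[u /existsP[v /andP[vu /eqP eE]]]; move: eM xe.
have nuv : u != v by apply: contraTneq vu => ->; apply: nbrs_irrefl.
rewrite eE !inE => eM /orP[]/eqP->.
  by rewrite (pairing_ofE (y := v)) // eq_sym.
by rewrite (pairing_ofE (y := u)) // setUC.
Qed.

Definition edge_set m : {set {set 'I_n}} := [set [set x; m x] | x in ~: unmatched m].

Lemma matching_edge_set m : pairing G m -> matching G (edge_set m).
Proof.
move=> [mK mG]; split.
  apply/subsetP=> _ /imsetP[x xm ->]; rewrite mem_edges.
  by move: xm; rewrite !inE => /mG.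
apply/trivIsetP=> _ _ /imsetP[x _ ->] /imsetP[y _ ->] neq.
rewrite -setI_eq0; apply/set0Pn=> -[z]; rewrite !inE.
case/andP=> /orP[]/eqP zx /orP[]/eqP zy; case/eqP: neq.
- by rewrite -zx -zy.
- by rewrite -zx zy mK setUC.
- by rewrite -zy zx mK setUC.
- by rewrite (inv_inj mK (etrans (esym zx) zy)).
Qed.

Lemma card_unmatched_edge_set m : pairing G m ->
  #|~: unmatched m| = 2 * #|edge_set m|.
Proof.
move=> mG; rewrite -card_cover_matching; last exact: matching_edge_set.
congr #|pred_of_set _|; apply/setP=> x; apply/idP/bigcupP => [xm|].
  by exists [set x; m x]; rewrite ?set21 //; apply: imset_f.
move=> [_ /imsetP[y ym ->]]; move: ym; rewrite !inE => ym /orP[]/eqP-> //.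
by rewrite mG.1 eq_sym.
Qed.

(** A query is thus settled by the partner of a single end of the edge. *)
Lemma mem_edge_set m e x : pairing G m -> e \in edges G -> x \in e ->
  (e \in edge_set m) = (e == [set x; m x]).
Proof.
move=> [mK _] eE xe; apply/imsetP/eqP => [[y _ eq_e]|eq_e].
  by move: xe; rewrite eq_e !inE => /orP[]/eqP->; rewrite ?mK // setUC.
exists x => //; rewrite !inE; apply/eqP=> mx.
by have := card_edge eE; rewrite eq_e mx setUid cards1.
Qed.

End EdgeSets.

(** * Probe cost of the recursion *)

Section ComputableMatched.
Variables (n D r Q cc : nat) (col : labeled_graph n -> 'I_n -> nat).
Hypothesis computable_col : forall v, computable D cc (fun G => col G v).

Let X := D.+1 ^ r.

Lemma computable_center c x :
  computable D (X + X * cc) (fun G => center r col G c x).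
Proof.
pose g b G := ohead [seq v <- b | col G v == c].
apply: (computable_bind (f := fun G => ball G r x) (g := g) (sz := size)
  (q2 := fun z => z * cc) (computable_ball _ _ _)) => [b|G GD]; last first.
  by rewrite leq_add2l leq_mul2r size_ball ?orbT.
apply: (computable_ext (f := fun G =>
  ohead [seq v.1 | v <- [seq (w, col G w) | w <- b] & v.2 == c])).
  by move=> G _; rewrite /g filter_map -map_comp map_id.
apply: (computable_comp (fun l => ohead [seq v.1 | v <- l & v.2 == c])).
by apply: computable_map => w; apply: (computable_comp (pair w)).
Qed.

(** A step calls the previous matching at [x] and on one ball, at most [X + 1] times; the other
    probes number at most [X * (cc + D + 2)], which one more copy of [q] absorbs. *)
Lemma computable_matched t x :
  computable D (X.+2 ^ t * (X * (cc + D + 2))) (fun G => matched r Q col G t x).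
Proof.
elim: t x => [|t IHt] x; first exact: computable_le (computable_cst _ _ _).
set q := _ * _ in IHt; pose mt G := matched r Q col G t.
pose g (o : option 'I_n) G := if o is Some v
  then augment (mt G) (improvement G (mt G) (ball G r v)) x else mt G x.
have cimp v : computable D (X + X * (D + q))
    (fun G => improvement G (mt G) (ball G r v)).
  apply: (computable_factor [ffun y => y]
    (f := fun G => (ball G r v, [seq (nbrs G y, mt G y) | y <- ball G r v]))).
    pose h b G := (b, [seq (nbrs G y, mt G y) | y <- b]).
    apply: (computable_bind (f := fun G => ball G r v) (g := h) (sz := size)
      (q2 := fun z => z * (D + q)) (computable_ball _ _ _)) => [b|G GD].
      apply: (computable_comp (pair b)); apply: computable_map => y.
      by apply: computable_pair; [apply: computable_nbrs|apply: IHt].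
    by rewrite leq_add2l leq_mul2r size_ball ?orbT.
  move=> G G' _ _ [<- /eq_in_map eq_map].
  by apply: improvement_local => y /eq_map [].
have cg o : computable D (q + (X + X * (D + q))) (g o).
  case: o => [v|] /=; last by apply: computable_le (IHt x); apply: leq_addr.
  apply: (computable_comp (fun z : 'I_n * {ffun 'I_n -> 'I_n} =>
    if z.2 x == x then z.1 else z.2 x)
    (f := fun G => (mt G x, improvement G (mt G) (ball G r v)))).
  by apply: computable_pair; [apply: IHt|apply: cimp].
apply: (computable_ext (f := fun G => g (center r col G (t %% Q) x) G)).
  move=> G _; rewrite /g /= /augment /patch; case: center => [v|] //.
  by rewrite eqxx.
apply: computable_le (computable_bindc (computable_center _ _) cg).
rewrite expnS -mulnA -/q.
have le_q : X * (cc + D + 2) <= q by rewrite leq_pmull // expn_gt0.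
have X_gt0 : 0 < X by rewrite expn_gt0.
by clear IHt cg cimp; move: q le_q => q; nia.
Qed.

End ComputableMatched.

(* Here [X] stands for the bound [D.+1 ^ (2 * k)] on the size of a ball of radius
   [2 * k], [T] for the number of steps and [cc] for the cost of a colour. *)
Lemma cost_bound X k s Q T cc :
  9 <= X -> k <= X -> 0 < s -> Q <= (2 * ((X ^ 2) ^ 2 + 8)) ^ 2 ->
  T <= X ^ 3 * k * Q ->
  cc <= X ^ 2 + (X ^ 2).+1 * (X ^ 2 * (s.+1 * X ^ 2)) ->
  forall D, D <= X -> X.+2 ^ T * (X * (cc + D + 2)) <= s * 2 ^ X ^ 16.
Proof.
move=> X9 kX s_gt0 leQ leT lecc D DX.
have X_gt0 : 0 < X by lia.
have leXX i : 0 < X ^ i by rewrite expn_gt0 X_gt0.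
(* Everything is absorbed into powers of [X]: [cc <= s * X ^ 7], [Q <= X ^ 10], [T <= X ^ 14]. Then
   [X < 2 ^ X] and [X * (2 * X ^ 14 + 9) <= X ^ 16] finish. *)
have lecc' : cc <= s * X ^ 7.
  apply: leq_trans lecc _.
  have -> : X ^ 7 = X ^ 2 * (X ^ 2 * X ^ 3) by rewrite -!expnD.
  have -> : X ^ 3 = X * X ^ 2 by rewrite -expnS.
  by move: (X ^ 2) (leXX 2) => Y Y0; nia.
have leQ' : Q <= X ^ 10.
  apply: leq_trans leQ _; rewrite -[10]/(5 * 2) expnM leq_exp2r //.
  have -> : (X ^ 2) ^ 2 = X ^ 4 by rewrite -expnM.
  have -> : X ^ 5 = X * X ^ 4 by rewrite -expnS.
  have : 9 <= X ^ 4 by apply: leq_trans X9 _; rewrite -{1}[X]expn1 leq_pexp2l.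
  by move: (X ^ 4) => Y Y9; clear -X9 Y9; nia.
have leT' : T <= X ^ 14.
  apply: leq_trans leT _; rewrite -[14]/(3 + 1 + 10) !expnD expn1.
  by rewrite !leq_mul.
have leB : X * (cc + D + 2) <= s * X ^ 9.
  have -> : X ^ 9 = X * (X * X ^ 7) by rewrite -!expnS.
  rewrite mulnCA leq_mul2l; apply/orP; right.
  have : 1 < s * X ^ 7.
    apply: leq_trans (leq_pmull _ s_gt0); apply: (@leq_trans X); first by lia.
    by rewrite -{1}[X]expn1 leq_pexp2l.
  rewrite mulnCA; move: (s * X ^ 7) lecc' => Z leZ Z1.
  apply: leq_trans (_ : Z + X + 2 <= _); last by clear -X9 Z1; nia.
  by rewrite leq_add2r leq_add.
apply: leq_trans (leq_mul (leqnn _) leB) _; rewrite mulnCA leq_mul2l.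
apply/orP; right.
have leX2 : X.+2 <= X ^ 2 by clear -X9; rewrite expnS expn1; nia.
have : X.+2 ^ T * X ^ 9 <= X ^ (2 * X ^ 14 + 9).
  rewrite expnD leq_mul2r expnM; apply/orP; right.
  apply: leq_trans (_ : (X ^ 2) ^ T <= _).
    by case: T {leT leT'} => // T; rewrite leq_exp2r.
  by rewrite leq_pexp2l.
move=> /leq_trans; apply.
apply: leq_trans (_ : (2 ^ X) ^ (2 * X ^ 14 + 9) <= _).
  have : 0 < 2 * X ^ 14 + 9 by rewrite addn_gt0 orbT.
  by move: (_ + 9) => e e_gt0; rewrite leq_exp2r // ltnW // ltn_expl.
rewrite -expnM leq_pexp2l // -[16]/(1 + 15) expnD expn1 leq_mul2l.
apply/orP; right; rewrite expnS.
by move: (X ^ 14) (leXX 14) => Y Y0; clear -X9 Y0; nia.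
Qed.

Lemma matching_algorithm (n D k s : nat) :
  1 < D -> 0 < k -> n <= tower s -> 0 < s ->
  exists ans : {set 'I_n} -> probing n bool,
  forall G, degree_le D G -> exists M, [/\ matching G M,
    forall M', matching G M' -> k * (#|M'| - #|M|) <= 2 * #|M'| &
    forall e, e \in edges G ->
      exec G (ans e) = (e \in M) /\ probes G (ans e) <= s * 2 ^ (D ^ (64 * k))].
Proof.
move=> D_gt1 k_gt0 le_n s_gt0; set r := 2 * k; set X := D.+1 ^ r.
(* Colours are proper up to twice the radius, so that balls of equally coloured centres are
   disjoint. *)
have [Q [col [leQ col_lt col_proper ccol]]] := local_coloring D (r + r) le_n.
pose T := X ^ 3 * k * Q.
have XD : D.+1 ^ (r + r) = X ^ 2 by rewrite addnn -mul2n mulnC expnM.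
have X3 : D.+1 ^ (3 * r) = X ^ 3 by rewrite mulnC expnM.
have bound : X.+2 ^ T * (X * (X ^ 2 + (X ^ 2).+1 * (X ^ 2 * (s.+1 * X ^ 2)) + D + 2))
    <= s * 2 ^ (D ^ (64 * k)).
  apply: leq_trans (@cost_bound X k s Q T _ _ _ _ _ (leqnn _) (leqnn _) D _) _ => //.
  - have -> : 9 = 3 ^ 2 by [].
    apply: leq_trans (_ : D.+1 ^ 2 <= _); first by rewrite leq_exp2r.
    by rewrite leq_pexp2l // /r; lia.
  - apply: leq_trans (ltnW (ltn_expl k (ltnSn 1))) _.
    apply: leq_trans (_ : 2 ^ r <= _); first by rewrite leq_pexp2l // /r; lia.
    by rewrite leq_exp2r // /r ?muln_gt0 //; lia.
  - by rewrite -XD.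
  - apply: leq_trans (leqnSn D) _; rewrite -{1}[D.+1]expn1 leq_pexp2l // /r; lia.
  rewrite leq_mul2l leq_pexp2l ?orbT // /X -expnM.
  (* Since [D > 1], [X <= D ^ (4 * k)], so [X ^ 16 <= D ^ (64 * k)]. *)
  have leDD : D.+1 <= D ^ 2 by clear -D_gt1; rewrite expnS expn1; nia.
  apply: leq_trans (_ : (D ^ 2) ^ (r * 16) <= _).
    by rewrite leq_exp2r // /r; lia.
  by rewrite -expnM leq_pexp2l // /r; lia.
rewrite XD in ccol.
have cm x := computable_matched r Q ccol T x.
have /choice[ans ansP] : forall e : {set 'I_n}, exists t, forall G, degree_le D G ->
    exec G t = (if [pick x in e] is Some x
      then e == [set x; matched r Q col G T x] else false) /\
    probes G t <= s * 2 ^ (D ^ (64 * k)).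
  move=> e; case: pickP => [x _|_]; last by exists (Return false).
  apply: computable_le bound _.
  exact: (computable_comp (fun y => e == [set x; y])).
exists ans => G GD; set m := matched r Q col G T.
have mG : pairing G m by apply: pairing_matched => // v w; apply: col_proper.
exists (edge_set m); split; first exact: matching_edge_set.
- move=> M' MG'.
  have := sweeps_approximate k_gt0 GD (col_lt G)
    (fun v w => @col_proper G v w GD) (pairing_pairing_of MG').
  rewrite -/r X3 -/T -/m /= (card_unmatched_pairing_of MG').
  have := card_unmatched_edge_set mG; have := card_unmatched_pairing_of MG'.
  have := cardsC (unmatched m); have := cardsC (unmatched (pairing_of M')).
  rewrite card_ord => e1 e2 e3 e4.
  have -> : #|unmatched m| - #|unmatched (pairing_of M')| =
      2 * (#|M'| - #|edge_set m|).
    by clear -e1 e2 e3 e4; lia.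
  by rewrite mulnCA leq_pmul2l.
move=> e eE; have [-> ?] := ansP e G GD; split=> //.
case: pickP => [x xe|e0]; first by rewrite (mem_edge_set mG eE xe).
by have := card_edge eE; rewrite (eq_card0 e0).
Qed.

(** * Small degrees, the iterated logarithm and the final bound *)

Lemma max_degreeP (n : nat) (G : labeled_graph n) : degree_le (max_degree G) G.
Proof. by move=> v; apply: (leq_bigmax (F := deg G)). Qed.

Lemma matching_edges (n : nat) (G : labeled_graph n) :
  max_degree G <= 1 -> matching G (edges G).
Proof.
move=> G1; split=> //; apply/trivIsetP=> e f.
rewrite !inE => /existsP[u /existsP[v /andP[vu /eqP->]]].
case/existsP=> x /existsP[y /andP[yx /eqP->]] neq.
have nbr1 w a b : a \in nbrs G w -> b \in nbrs G w -> a = b.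
  have := leq_trans (max_degreeP G w) G1; rewrite /deg.
  by case: (nbrs G w) => [|c []] //= _; rewrite !inE => /eqP-> /eqP->.
rewrite -setI_eq0; apply/set0Pn=> -[z]; rewrite !inE.
have uv := vu; have xy := yx; rewrite nbrs_sym in uv; rewrite nbrs_sym in xy.
case/andP=> /orP[]/eqP zu /orP[]/eqP zx; case/eqP: neq; subst z.
- by subst x; rewrite (nbr1 _ _ _ vu yx).
- by subst y; rewrite (nbr1 _ _ _ vu xy) setUC.
- by subst x; rewrite (nbr1 _ _ _ uv yx) setUC.
- by subst y; rewrite (nbr1 _ _ _ uv xy).
Qed.

Import Order.TTheory GRing.Theory Num.Theory.
Local Open Scope ring_scope.

Lemma le_tower_logstar (R : realType) (n : nat) : (n <= tower (logstar R n))%N.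
Proof.
rewrite /logstar; case: ex_minnP => s + _.
suff H (x : R) : iter s (@log2 R) x <= 1 -> x <= (tower s)%:R.
  by move/H; rewrite ler_nat.
elim: s x => [|s IHs] x //; rewrite iterSr => /IHs le_log /=.
(* Exponentiating back is meaningful only for positive [x]. *)
have [x_le0|x_gt0] := leP x 0; first by apply: le_trans x_le0 (ler0n _ _).
have ln2_gt0 : 0 < ln (2 : R) by rewrite ln_gt0 // ltr1n.
move: le_log; rewrite /log2 ler_pdivrMr // mulr_natl -lnXn // ler_ln ?posrE //.
  by rewrite natrX.
by rewrite exprn_gt0.
Qed.

Lemma probe_bound_ge0 (R : realType) (C eps : R) (n D : nat) :
  0 <= probe_bound C eps n D.
Proof. by rewrite mulr_ge0 ?powR_ge0 // exprz_ge0. Qed.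

(** The constant is [192 = 64 * 3]. One factor [logstar R n] is at most its power, whose exponent is
    at least 1. *)
Lemma le_probe_bound (R : realType) (eps : R) (n D k : nat) :
  0 < eps -> k%:R <= 3 / eps -> (0 < D)%N -> (0 < logstar R n)%N ->
  (logstar R n * 2 ^ (D ^ (64 * k)))%:R <= probe_bound 192 eps n D.
Proof.
move=> eps_gt0 k_le D_gt0 s_gt0; rewrite natrM /probe_bound ler_pM //.
  have : 0 <= Num.ceil (1 / eps).
    by rewrite ceil_ge0 (lt_le_trans (ltrN10 _)) // divr_ge0 // ltW.
  case: (Num.ceil (1 / eps)) => // c _; rewrite -PoszD addn1 -exprnP.
  by rewrite exprS ler_peMr // exprn_ege1 // ler1n.
rewrite natrX -powR_mulrn // ler_powR ?ler1n // natrX -powR_mulrn //.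
by rewrite ler_powR ?ler1n // natrM; lra.
Qed.

Theorem theorem19 (R : realType) :
  exists C : R, 0 < C /\
    forall eps : R, 0 < eps -> eps < 1 ->
      exists A : edge_algorithm,
        stateless A /\
        CentLocal (approx_max_matching eps) (probe_bound C eps) A.
Proof.
exists 192; split=> // eps eps_gt0 eps_lt1.
(* The ratio obtained is [1 - 2 / k], so [k] must be at least [2 / eps]; rounding up stays below
   [3 / eps] as [eps < 1]. *)
have [k le_k k_le] : exists2 k : nat, 2 <= eps * k%:R & k%:R <= 3 / eps.
  exists (Num.truncn (2 / eps)).+1.
    by rewrite mulrC -ler_pdivrMr // ltW // truncnS_gt.
  rewrite -natr1; apply: le_trans (_ : 2 / eps + 1 / eps <= _); last by lra.
  rewrite lerD ?truncn_le //; first by rewrite divr_ge0 // ltW.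
  by rewrite ler_pdivlMr // mul1r ltW.
have k_gt0 : (0 < k)%N by case: k le_k {k_le} => //; rewrite mulr0 lt_geF.
(* The strategy is fixed before [G], so it depends on [n] and [D] only; this makes the algorithm
   stateless. *)
have H n D : exists ans : {set 'I_n} -> probing n bool,
    forall G, max_degree G = D -> exists M, approx_max_matching eps G M /\
      forall e, e \in edges G -> exec G (ans e) = (e \in M) /\
        (probes G (ans e))%:R <= probe_bound 192 eps n D.
  have [D_le1|D_gt1] := leqP D 1.
    exists (fun=> Return true) => G GD; exists (edges G); split; last first.
      by move=> e ->; rewrite probe_bound_ge0.
    split; first by apply: matching_edges; rewrite GD.
    move=> M [[ME _] _]; apply: le_trans (_ : #|M|%:R <= _).
      by rewrite ler_piMl //; lra.
    by rewrite ler_nat subset_leq_card.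
  (* A zero [logstar] forces [n <= 1], incompatible with a degree above 1. *)
  have [s0|s_gt0] := posnP (logstar R n).
    exists (fun=> Return true) => G GD; exfalso.
    have := le_tower_logstar R n; rewrite s0 => n_le1.
    suff: (max_degree G <= 1)%N by rewrite GD leqNgt D_gt1.
    apply/bigmax_leqP=> v _; apply: leq_trans n_le1.
    have := max_card (mem (nbrs G v)).
    by rewrite card_ord (card_uniqP (nbrs_uniq G v)).
  have [ans ansP] := matching_algorithm D_gt1 k_gt0 (le_tower_logstar R n) s_gt0.
  exists ans => G GD; have [|M [MG Mopt Mans]] := ansP G.
    by rewrite -GD; apply: max_degreeP.
  exists M; split; last first.
    move=> e /Mans[-> le_p]; split=> //.
    apply: le_trans (le_probe_bound eps_gt0 k_le (ltnW D_gt1) s_gt0).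
    by rewrite ler_nat.
  split=> // M' [MG' _].
  have kR_gt0 : 0 < k%:R :> R by rewrite ltr0n.
  have {Mopt} : k%:R * (#|M'|%:R - #|M|%:R) <= 2 * #|M'|%:R :> R.
    rewrite -[2]/(2%:R) -[2%:R * _]natrM.
    apply: le_trans (_ : (k * (#|M'| - #|M|))%:R <= _).
      by rewrite natrM ler_pM2l // lerBlDr -natrD ler_nat; lia.
    by rewrite ler_nat Mopt.
  have a_ge0 : 0 <= #|M'|%:R :> R by [].
  move=> le1; rewrite -(ler_pM2l kR_gt0); nra.
pose ans n D := sval (cid (H n D)).
exists (@EdgeAlgorithm (fun _ _ => unit) (fun _ _ => tt)
  (fun n D _ e => bind (ans n D e) (fun b => Return (b, tt)))); split.
  by move=> n D [] [].
move=> n G; have [M [MG Mans]] := svalP (cid (H n (max_degree G))) G erefl.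
exists M; split=> // qs; elim: qs => [|e qs IHqs] //= sub.
have eE : e \in edges G by apply: sub; rewrite mem_head.
have [Me pe] := Mans e eE.
have [|IH1 IH2] := IHqs; first by move=> f fq; apply: sub; rewrite inE fq orbT.
rewrite exec_bind probes_bind /= addn0; split.
  by rewrite Me; congr (_ :: _).
by move=> p; rewrite inE => /orP[/eqP->|/IH2].
Qed.
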